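(* Let $G$ be a hyperbolic group, $n,m\in\mathbb{N}$ ($n,m\ge 1$), let $G_1,\dots,G_n$, $H_1,\dots,H_m$ be quasiconvex subgroups of $G$, and let $f,e\in G$. Then there exist numbers $r, t_l \in \mathbb{N}\cup\{0\}$ ($l=1,2,\dots,r$) and elements $f_l, \alpha_{lk},\beta_{lk}\in G$ ($l=1,\dots,r$; $k=1,2,\dots,t_l$ for each fixed $l$) such that $$fG_1G_2\cdots G_n \cap eH_1H_2\cdots H_m = \bigcup_{l=1}^r f_l S_l,$$ where for each $l$, writing $t=t_l$, there are indices $1\le i_1\le i_2\le\dots\le i_t\le n$ and $1\le j_1\le j_2\le\dots\le j_t\le m$ (depending on $l$) such that $$S_l = (G_{i_1}^{\alpha_{l1}}\cap H_{j_1}^{\beta_{l1}})\cdots(G_{i_t}^{\alpha_{lt}}\cap H_{j_t}^{\beta_{lt}}).$$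
   Context: For a subgroup $H\le G$ and $x\in G$, $H^x = xHx^{-1}$. For subsets $A,B\subseteq G$, $AB=\{ab\mid a\in A, b\in B\}$; an empty product of subgroups ($t=0$) is $\{1_G\}$, and an empty union ($r=0$) is the empty set. Let $\mathcal{A}$ be a finite symmetrized generating set of $G$ and $\Gamma(G,\mathcal{A})$ the Cayley graph. A subset $Q\subseteq G$ is quasiconvex if there is $\varepsilon\ge 0$ such that every geodesic in $\Gamma(G,\mathcal{A})$ connecting two elements of $Q$ lies in the closed $\varepsilon$-neighborhood of $Q$ (in a hyperbolic group this does not depend on the choice of $\mathcal{A}$). *)

(* Defs.v *)
From HB Require Import structures.
From mathcomp Require Import all_boot.
From mathcomp Require Import boolp classical_sets.

Set Implicit Arguments.
Unset Strict Implicit.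
Unset Printing Implicit Defensive.

Local Open Scope classical_set_scope.
Local Open Scope group_scope.

Section SubsetsOfGroups.
Variable G : groupType.
Implicit Types (A B H : set G) (x : G).

Definition subgroup H : Prop :=
  [/\ H 1, forall x y, H x -> H y -> H (x * y) & forall x, H x -> H x^-1].

(* H ^ x = x H x^-1, whereas the library's x ^ y is y^-1 * x * y. *)
Definition set_conj H x : set G := [set x * h * x^-1 | h in H].

Definition set_mul A B : set G := [set a * b | a in A & b in B].

Definition translate x A : set G := [set x * a | a in A].

Definition set_prod (t : nat) (F : 'I_t -> set G) : set G :=
  \big[set_mul/[set 1]]_(k < t) F k.

End SubsetsOfGroups.

(* The Cayley graph is used through its vertices and edge paths: a path from x
   is x :: p with path (cayley A) x p, and a geodesic between group elements is
   an edge path of minimal length. Distances between vertices are natural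
   numbers, so the constants delta and epsilon are natural numbers too; passing
   to points inside edges would only change these constants by a bounded
   amount. *)
Section CayleyGraph.
Variables (G : groupType) (A : seq G).
Implicit Types (x y z g : G) (p q r : seq G) (Q : set G).

Definition symmetrized_generating_set : Prop :=
  (forall a, a \in A -> a^-1 \in A) /\
  (forall g, exists2 s : seq G, all [in A] s & g = \prod_(a <- s) a).

Definition cayley : rel G := fun x y => x^-1 * y \in A.

Definition edge_path x y p : Prop := path cayley x p /\ last x p = y.

Definition geodesic x y p : Prop :=
  edge_path x y p /\ forall q, edge_path x y q -> (size p <= size q)%N.

Definition neighborhood (k : nat) Q : set G :=
  [set x | exists y p, [/\ Q y, edge_path x y p & (size p <= k)%N]].

(* Rips' condition: every geodesic triangle is delta-slim. *)
Definition hyperbolic : Prop :=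
  exists delta : nat, forall x y z p q r,
    geodesic x y p -> geodesic y z q -> geodesic z x r ->
    [set` x :: p] `<=` neighborhood delta ([set` y :: q] `|` [set` z :: r]).

Definition quasiconvex Q : Prop :=
  exists epsilon : nat, forall x y p, Q x -> Q y -> geodesic x y p ->
    [set` x :: p] `<=` neighborhood epsilon Q.

End CayleyGraph.

(* Main.v *)
Require Import Defs.
From HB Require Import structures.
From mathcomp Require Import all_boot.
From mathcomp Require Import boolp classical_sets.
From mathcomp Require Import zify.

(** Write U_i for the subgroups on one side and V_j for those on the other. The
    proof is by induction on the total number of factors, for the slightly more
    general intersections
      [f U_i0 ... U_(i1-1) meet e V_j0 ... V_(j1-1) b].
    With one factor on each side, two cosets of subgroups meet in the empty set
    or in a coset of the intersection of conjugates of these subgroups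
    (decomposable_coset_meet).

    Suppose that there are at least two factors U_i; otherwise the two sides
    change roles. A point x of the intersection is the common end of two broken
    lines, one from f with sides in cosets of the U_i and one from e with sides
    in cosets of the V_j, up to the bounded distance between x and x b^-1. In
    the geodesic triangle spanned by f, the end of the first side, and x, some
    vertex is close to all three edges (slim_center). By hyperbolicity and
    quasiconvexity it is therefore close to a point u of the coset f U_i0, to a
    point v of a coset belonging to a later side k, and, as the geodesic from f
    to x follows the other broken line, to a point w of a coset belonging to
    some side j there (interval_prod_near_geodesic, meeting_point). All bounds
    are independent of x.

    The elements a = u^-1 v and c = w^-1 u are short, so only finitely many
    occur. Once k, j, a and c are fixed, x = u a (v^-1 x) is the product of a
    point of f U_i0 meet e V_j0 ... V_j c, of the element a, and of a point of
    U_k ... U_(i1-1) meet (c a)^-1 V_j ... V_(j1-1) b. Conversely every such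
    product lies in the original intersection, because the repeated factors U_i
    and V_j are subgroups and absorb their copies. Hence the intersection is a
    finite union of products of two intersections with fewer factors
    (prod_meet_split). The sets of the required form are closed under finite
    unions, and under products when the indices of the first set do not exceed
    those of the second (decomposable_mul), so that the induction closes. *)

Set Implicit Arguments.
Unset Strict Implicit.
Unset Printing Implicit Defensive.

Local Open Scope classical_set_scope.
Local Open Scope group_scope.

(** * Words in a group *)

(** Rewriting with these rules brings a product of letters and inverses to its
    right-associated reduced form, which decides identities of free groups. *)
Definition reduce_word (G : groupType) :=
  (fun x y z : G => esym (mulgA x y z), @invgM G, @invgK G, @invg1 G,
   @mulg1 G, @mul1g G,
   @mulgV G, @mulVg G, @mulKg G, @mulVKg G).

(** * Vertices within bounded distance and on geodesics *)

Section Geometry.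
Variables (G : groupType) (A : seq G).
Implicit Types (x y z v w g : G) (p q : seq G) (P Q : G -> Prop).

Definition near k x y := exists2 p, edge_path A x y p & size p <= k.

Definition between x v y := exists2 p, geodesic A x y p & v \in x :: p.

Lemma near_refl x : near 0 x x. Proof. by exists [::]. Qed.

Lemma near_leq k l x y : k <= l -> near k x y -> near l x y.
Proof. by move=> kl [p Ap pk]; exists p => //; apply: leq_trans kl. Qed.

Lemma near_trans k l x y z : near k x y -> near l y z -> near (k + l) x z.
Proof.
move=> [p [Ap py] pk] [q [Aq qz] ql]; exists (p ++ q); last first.
  by rewrite size_cat leq_add.
by split; rewrite ?cat_path ?last_cat py ?Ap.
Qed.

Lemma edge_path_translate g x y p :
  edge_path A x y p -> edge_path A (g * x) (g * y) (map (mul g) p).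
Proof.
move=> [Ap py]; split; last by rewrite last_map py.
rewrite path_map; apply: sub_path Ap => a b.
by rewrite /cayley /= !reduce_word.
Qed.

Lemma near_translate g k x y : near k x y -> near k (g * x) (g * y).
Proof.
move=> [p /(edge_path_translate g) Ap pk]; exists (map (mul g) p) => //.
by rewrite size_map.
Qed.

Lemma geodesic_translate g x y p :
  geodesic A x y p -> geodesic A (g * x) (g * y) (map (mul g) p).
Proof.
move=> [Ap minp]; split=> [|q /(edge_path_translate g^-1)].
  exact: edge_path_translate.
by rewrite !mulKg size_map => /minp; rewrite size_map.
Qed.

Lemma between_translate g x v y :
  between x v y -> between (g * x) (g * v) (g * y).
Proof.
move=> [p geo_p vp]; exists (map (mul g) p); first exact: geodesic_translate.
by rewrite -[_ :: _]/(map (mul g) (x :: p)) map_f.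
Qed.

Lemma neighborhoodP k (Q : set G) v :
  neighborhood A k Q v -> exists2 w, Q w & near k v w.
Proof. by move=> [w [p [Qw vw pk]]]; exists w => //; exists p. Qed.

(** Finiteness of balls is where the finiteness of the generating set enters. *)
Lemma near_finite k :
  exists s : seq G, forall x y, near k x y -> x^-1 * y \in s.
Proof.
elim: k => [|k [s ball_s]].
  exists [:: 1] => x y [[|//] [_ <-] _].
  by rewrite mulVg mem_seq1.
exists (1 :: [seq a * b | a <- A, b <- s]) => x y [[|a p] [/= Ap py] pk].
  by rewrite -py mulVg mem_head.
case/andP: Ap => xa Ap; rewrite inE; apply/orP; right.
apply/allpairsP; exists (x^-1 * a, a^-1 * y); split=> //=.
  by apply: ball_s; exists p.
by rewrite !reduce_word.
Qed.

(** Discrete connectedness of a path: on the way from P to Q, some edge leads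
    from a vertex with P to one with Q. *)
Lemma path_crossing P Q x p :
    path (cayley A) x p -> (forall v, v \in x :: p -> P v \/ Q v) ->
    P x -> Q (last x p) ->
  exists v w, [/\ v \in x :: p, P v, Q w & near 1 v w].
Proof.
elim: p x => [|y p IHp] x /= Ap PQ Px Qp.
  exists x, x; split=> //; first exact: mem_head.
  exact: near_leq (near_refl x).
case/andP: Ap => xy Ap; case: (PQ y) => [|Py|Qy].
- by rewrite inE mem_head orbT.
- have [|v [w [vp Pv Qw vw]]] := IHp y Ap _ Py Qp.
    by move=> v vp; apply: PQ; rewrite inE vp orbT.
  by exists v, w; split=> //; rewrite inE vp orbT.
- exists x, y; split=> //; first exact: mem_head.
  by exists [:: y] => //; split=> //=; rewrite xy.
Qed.

Hypothesis hA : symmetrized_generating_set A.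

Lemma edge_path_rev x y p :
  edge_path A x y p -> edge_path A y x (rev (belast x p)).
Proof.
move=> [Ap <-]; split; last first.
  by case: p {Ap} => //= a p; rewrite rev_cons last_rcons.
rewrite rev_path; apply: sub_path Ap => a b ab.
by have := hA.1 _ ab; rewrite invgM invgK.
Qed.

Lemma near_sym k x y : near k x y -> near k y x.
Proof.
move=> [p /edge_path_rev Ap pk]; exists (rev (belast x p)) => //.
by rewrite size_rev size_belast.
Qed.

Lemma between_sym x v y : between x v y -> between y v x.
Proof.
move=> [p [Ap minp] vp]; exists (rev (belast x p)).
  split=> [|q /edge_path_rev /minp]; first exact: edge_path_rev.
  by rewrite !size_rev !size_belast.
by case: Ap => _ <-; rewrite -rev_rcons -lastI mem_rev.
Qed.

Lemma edge_path_exists x y : exists p, edge_path A x y p.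
Proof.
have [s As def_y] := hA.2 (x^-1 * y).
elim: s x As def_y => [|a s IHs] x /=.
  rewrite big_nil => _ xy; exists [::]; split=> //=.
  by rewrite -[y](mulVKg x) xy mulg1.
move=> /andP[Aa As]; rewrite big_cons => def_y.
have [|p [Ap py]] := IHs (x * a) As.
  by rewrite invgM -mulgA def_y mulKg.
by exists (x * a :: p); split=> //=; rewrite /cayley mulKg Aa.
Qed.

Lemma near_exists x y : exists k, near k x y.
Proof. by have [p Ap] := edge_path_exists x y; exists (size p), p. Qed.

Lemma geodesic_exists x y : exists p, geodesic A x y p.
Proof.
have exn : exists n, `[< exists2 p, edge_path A x y p & size p = n >].
  have [p Ap] := edge_path_exists x y; exists (size p).
  by apply/asboolP; exists p.
case: (ex_minnP exn) => n /asboolP[p Ap pn] minn.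
exists p; split=> // q Aq; rewrite pn; apply: minn.
by apply/asboolP; exists q.
Qed.

Lemma between_left x y : between x x y.
Proof. by have [p geo_p] := geodesic_exists x y; exists p; rewrite ?mem_head. Qed.

Lemma between_near k x v y : between x v y -> near k x y -> near k x v.
Proof.
move=> [p [[Ap py] minp] vp] [q Aq qk]; have pk := leq_trans (minp q Aq) qk.
case/splitPl: p / vp Ap py pk {minp} => p1 p2 p1v.
rewrite cat_path size_cat => /andP[Ap1 _] _ pk.
by exists p1 => //; apply: leq_trans pk; apply: leq_addr.
Qed.

Definition slim delta := forall x y z v, between x v y ->
  exists2 w, between x w z \/ between z w y & near delta v w.

Lemma hyperbolic_slim : hyperbolic A -> exists delta, slim delta.
Proof.
move=> [delta slim_delta]; exists delta => x y z v [p geo_p vp].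
have [q geo_q] := geodesic_exists y z; have [r geo_r] := geodesic_exists z x.
have /neighborhoodP[w [wq|wr] vw] := slim_delta _ _ _ _ _ _ geo_p geo_q geo_r v vp.
  by exists w => //; right; apply: between_sym; exists q.
by exists w => //; left; apply: between_sym; exists r.
Qed.

(** Slimness says that every vertex of one side is close to the union of the
    other two; since the two ends of that side lie on different ones, somewhere
    along it both are close at once. *)
Lemma slim_center delta x y z : slim delta ->
  exists c u v, [/\ between x c y, between x u z, between z v y,
    near delta c u & near delta.+1 c v].
Proof.
move=> slim_delta; have [p [[Ap py] minp]] := geodesic_exists x y.
have geo_p : geodesic A x y p by [].
pose P c := exists2 u, between x u z & near delta c u.
pose Q c := exists2 v, between z v y & near delta c v.
case: (@path_crossing P Q x p Ap) => [c cp|||c [d [cp [u xuz cu] [v zvy dv] cd]]].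
- have [|w [?|?] cw] := slim_delta x y z c; first by exists p.
    by left; exists w.
  by right; exists w.
- by exists x; [apply: between_left | apply: near_leq (near_refl x)].
- rewrite py; exists y; first exact/between_sym/between_left.
  exact: near_leq (near_refl y).
exists c, u, v; split=> //; first by exists p.
exact: near_trans cd dv.
Qed.

End Geometry.

(** * Products of consecutive subgroups *)

Section SetProducts.
Variable G : groupType.
Implicit Types (P Q : set G) (U : nat -> set G) (x y : G).

Lemma set_mulP P Q x : set_mul P Q x <-> exists2 a, P a & Q (a^-1 * x).
Proof.
split=> [[a Pa [b Qb <-]]|[a Pa Qb]]; first by exists a; rewrite ?mulKg.
by exists a => //; exists (a^-1 * x); rewrite ?mulVKg.
Qed.

Lemma translateP P f x : translate f P x <-> P (f^-1 * x).
Proof.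
split=> [[a Pa <-]|Px]; first by rewrite mulKg.
by exists (f^-1 * x); rewrite ?mulVKg.
Qed.

Lemma set_conjP P g x : set_conj P g x <-> P (g^-1 * x * g).
Proof.
split=> [[a Pa <-]|Px]; first by rewrite !reduce_word.
by exists (g^-1 * x * g); rewrite ?mulgA ?mulgV ?mul1g ?mulgK.
Qed.

Lemma set_mulA : associative (@set_mul G).
Proof.
move=> P Q R; apply/seteqP; split=> x.
  move=> /set_mulP[a Pa /set_mulP[b Qb Rc]]; apply/set_mulP; exists (a * b).
    by exists a => //; exists b.
  by rewrite invgM -mulgA.
move=> /set_mulP[_ [a Pa [b Qb <-]] Rc]; apply/set_mulP; exists a => //.
by apply/set_mulP; exists b => //; rewrite mulgA -invgM.
Qed.

Lemma set_mul1l : left_id [set 1] (@set_mul G).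
Proof.
move=> P; apply/seteqP; split=> x => [/set_mulP[_ ->]|Px].
  by rewrite invg1 mul1g.
by apply/set_mulP; exists 1; rewrite // invg1 mul1g.
Qed.

Lemma set_mul1r : right_id [set 1] (@set_mul G).
Proof.
move=> P; apply/seteqP; split=> x => [/set_mulP[a Pa ax]|Px].
  by rewrite -[x](mulVKg a) ax mulg1.
by apply/set_mulP; exists x; rewrite // mulVg.
Qed.

HB.instance Definition _ :=
  Monoid.isLaw.Build (set G) [set 1] (@set_mul G) set_mulA set_mul1l set_mul1r.

Definition interval_prod U i k : set G :=
  \big[@set_mul G/[set 1]]_(i <= l < k) U l.

Lemma interval_prod1 U i : interval_prod U i i.+1 = U i.
Proof. exact: big_nat1. Qed.

Lemma interval_prod_cat U i k l : i <= k -> k <= l ->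
  interval_prod U i l = set_mul (interval_prod U i k) (interval_prod U k l).
Proof. exact: big_cat_nat. Qed.

Lemma interval_prodM U i k l x y : i <= k -> k <= l ->
  interval_prod U i k x -> interval_prod U k l y -> interval_prod U i l (x * y).
Proof.
by move=> ik kl Ux Uy; rewrite (interval_prod_cat _ ik kl); exists x => //; exists y.
Qed.

Lemma interval_prod_cons U i l x : i < l ->
  interval_prod U i l x -> exists2 a, U i a & interval_prod U i.+1 l (a^-1 * x).
Proof.
by move=> il; rewrite /interval_prod big_ltn // => /set_mulP.
Qed.

Section Subgroups.
Variable U : nat -> set G.
Hypothesis U_sub : forall i, subgroup (U i).

(** The repeated factor is absorbed because it is a subgroup. *)
Lemma interval_prod_overlap i k l x y : i <= k -> k < l ->
    interval_prod U i k.+1 x -> interval_prod U k l y ->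
  interval_prod U i l (x * y).
Proof.
move=> ik kl.
rewrite (interval_prod_cat _ ik (leqnSn k)) interval_prod1 => /set_mulP[a Ua Ub].
move=> /(interval_prod_cons kl)[c Uc Ud].
have -> : x * y = a * ((a^-1 * x * c) * (c^-1 * y)) by rewrite !reduce_word.
apply: (interval_prodM ik (ltnW kl) Ua).
apply: (interval_prodM (leqnSn k) kl _ Ud); rewrite interval_prod1.
by case: (U_sub k) => _ UM _; apply: UM.
Qed.

End Subgroups.
End SetProducts.

(** * The sides of a broken line stay close to its geodesic *)

Section BrokenLines.
Variables (G : groupType) (A : seq G).
Hypotheses (hA : symmetrized_generating_set A) (hG : hyperbolic A).
Variable U : nat -> set G.
Hypothesis U_sub : forall i, subgroup (U i).
Hypothesis U_qc : forall i, quasiconvex A (U i).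

(** Cutting off one side of the broken line at a time by a slim triangle, a
    vertex of the geodesic is close to a vertex of some side, hence by
    quasiconvexity to a point of a coset of U l, which splits the product. *)
Lemma interval_prod_near_geodesic i k : i < k ->
  exists K, forall x y v, interval_prod U i k (x^-1 * y) -> between A x v y ->
    exists l w, [/\ i <= l < k, near A K v w,
      interval_prod U i l.+1 (x^-1 * w) & interval_prod U l k (w^-1 * y)].
Proof.
have [delta slim_delta] := hyperbolic_slim hA hG.
move=> ik; have [n def_k] : exists n, k = i + n.+1.
  by exists (k - i).-1; rewrite prednK ?subn_gt0 // subnKC // ltnW.
elim: n i ik def_k => [|n IHn] i ik def_k; have [eps U_eps] := U_qc i.
  have {}def_k : k = i.+1 by rewrite def_k addn1.
  exists eps => x y v; rewrite def_k interval_prod1 => Uxy.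
  move=> /(between_translate x^-1)[p geo_p vp]; rewrite mulVg in geo_p vp.
  have [U1 UM UV] := U_sub i.
  have /neighborhoodP[w Uw vw] := U_eps _ _ _ U1 Uxy geo_p _ vp.
  exists i, (x * w); rewrite leqnn leqnn; split=> //.
  - by have := near_translate x vw; rewrite mulVKg.
  - by rewrite interval_prod1 mulKg.
  - by rewrite interval_prod1 invgM -mulgA; apply: UM => //; apply: UV.
have iSk : i.+1 < k by rewrite def_k !addnS ltnS leq_addr.
have [|K near_K] := IHn i.+1 iSk; first by rewrite def_k addSnnS.
exists (delta + maxn eps K) => x y v /(interval_prod_cons ik)[a Ua Uaxy] xvy.
have [w [xwa|awy] vw] := slim_delta x y (x * a) v xvy.
  move: xwa => /(between_translate x^-1)[p geo_p wp].
  rewrite mulVg mulKg in geo_p wp; have [U1 UM UV] := U_sub i.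
  have /neighborhoodP[z Uz wz] := U_eps _ _ _ U1 Ua geo_p _ wp.
  exists i, (x * z); rewrite leqnn ik; split=> //.
  - apply: near_trans vw _; apply: near_leq (leq_maxl _ _) _.
    by have := near_translate x wz; rewrite mulVKg.
  - by rewrite interval_prod1 mulKg.
  - have -> : (x * z)^-1 * y = (z^-1 * a) * (a^-1 * (x^-1 * y)).
      by rewrite !reduce_word.
    apply: (interval_prodM (leqnSn i) (ltnW iSk) _ Uaxy).
    by rewrite interval_prod1; apply: UM => //; apply: UV.
have [|l [z [/andP[il lk] wz Uz Uzy]]] := near_K (x * a) y w _ awy.
  by rewrite invgM -mulgA.
exists l, z; split=> //; first by rewrite (ltnW il).
  by apply: near_trans vw _; apply: near_leq wz; apply: leq_maxr.
have -> : x^-1 * z = a * ((x * a)^-1 * z) by rewrite !reduce_word.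
by apply: (interval_prodM (leqnSn i) (leqW il) _ Uz); rewrite interval_prod1.
Qed.

End BrokenLines.

(** * Finite unions of products of intersections *)

Section Decomposable.
Variable G : groupType.
Implicit Types (U V : nat -> set G) (P Q : set G) (R : pred (nat * nat)).
Implicit Types (x y f b : G).

Definition piece : Type := (nat * nat) * (G * G).
Implicit Types (q : piece) (s : seq piece) (l : G * seq piece).

Definition piece_set U V q : set G :=
  set_conj (U q.1.1) q.2.1 `&` set_conj (V q.1.2) q.2.2.

Definition pieces_prod U V s : set G :=
  \big[@set_mul G/[set 1]]_(q <- s) piece_set U V q.

Definition pieces_coset U V l : set G := translate l.1 (pieces_prod U V l.2).

Definition index_le (c d : nat * nat) := (c.1 <= d.1) && (c.2 <= d.2).

Definition pieces_ordered R s :=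
  pairwise (fun q q' => index_le q.1 q'.1) s && all (fun q => R q.1) s.

(** R records where the indices lie, because a product of two such sets has
    monotone indices only if those of the first do not exceed those of the
    second. *)
Definition decomposable U V R P := exists2 L : seq (G * seq piece),
  all (fun l => pieces_ordered R l.2) L &
  P = [set x | exists2 l, l \in L & pieces_coset U V l x].

Lemma set_conj_mul g : {morph (fun P => set_conj P g) : P Q / set_mul P Q}.
Proof.
move=> P Q; apply/seteqP; split=> x.
  move=> /set_conjP/set_mulP[a Pa Qx]; apply/set_mulP; exists (g * a * g^-1).
    by exists a.
  apply/set_conjP; move: Qx; congr Q; by rewrite !reduce_word.
move=> /set_mulP[_ [a Pa <-] /set_conjP Qx]; apply/set_conjP/set_mulP.
by exists a => //; move: Qx; congr Q; rewrite !reduce_word.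
Qed.

Lemma set_conj1 g : set_conj [set 1] g = [set 1 : G].
Proof.
apply/seteqP; split=> x => [[_ -> <-]|->] /=; first by rewrite !reduce_word.
by exists 1; rewrite ?mulg1 ?mulgV.
Qed.

Lemma set_conjI g P Q : set_conj (P `&` Q) g = set_conj P g `&` set_conj Q g.
Proof.
apply/seteqP; split=> x => [/set_conjP[Px Qx]|[/set_conjP Px /set_conjP Qx]].
  by split; apply/set_conjP.
exact/set_conjP.
Qed.

Lemma set_conjM g h P : set_conj (set_conj P h) g = set_conj P (g * h).
Proof.
apply/seteqP; split=> x => [/set_conjP/set_conjP Px|/set_conjP Px].
  by apply/set_conjP; move: Px; congr P; rewrite !reduce_word.
by apply/set_conjP/set_conjP; move: Px; congr P; rewrite !reduce_word.
Qed.

Definition piece_conj g q : piece := (q.1, (g * q.2.1, g * q.2.2)).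

Lemma pieces_prod_conj U V g s :
  set_conj (pieces_prod U V s) g = pieces_prod U V (map (piece_conj g) s).
Proof.
rewrite /pieces_prod big_map.
rewrite (big_morph _ (set_conj_mul g) (set_conj1 g)).
by apply: eq_bigr => q _; rewrite /piece_set set_conjI !set_conjM.
Qed.

(** Moving the representative of the second coset to the front conjugates the
    factors of the first; this is why conjugating elements are needed. *)
Definition coset_mul l l' : G * seq piece :=
  (l.1 * l'.1, map (piece_conj l'.1^-1) l.2 ++ l'.2).

Lemma pieces_coset_mul U V l l' :
  set_mul (pieces_coset U V l) (pieces_coset U V l') =
  pieces_coset U V (coset_mul l l').
Proof.
rewrite /pieces_coset /pieces_prod big_cat -!/(pieces_prod _ _ _).
rewrite -pieces_prod_conj; apply/seteqP; split=> x.
  move=> [_ [a la <-] [_ [c lc <-] <-]]; exists (l'.1^-1 * a * l'.1 * c).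
    exists (l'.1^-1 * a * l'.1); last by exists c.
    by exists a; rewrite // invgK.
  by rewrite !reduce_word.
move=> [_ [_ [a la <-] [c lc <-]] <-]; exists (l.1 * a); first by exists a.
by exists (l'.1 * c); [exists c | rewrite !reduce_word].
Qed.

Lemma pieces_ordered_mul R1 R2 R l l' :
    (forall c d, R1 c -> R2 d -> index_le c d) -> subpred R1 R -> subpred R2 R ->
    pieces_ordered R1 l.2 -> pieces_ordered R2 l'.2 ->
  pieces_ordered R (coset_mul l l').2.
Proof.
move=> R12 R1R R2R /andP[ord_l R1l] /andP[ord_l' R2l'].
rewrite /pieces_ordered pairwise_cat pairwise_map ord_l' ord_l all_cat all_map.
rewrite !andbT; apply/and3P; split.
- apply/allrelP => _ d /mapP[c cl ->] dl' /=.
  by apply: R12; [apply: (allP R1l) | apply: (allP R2l')].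
- by apply/allP => c cl /=; apply/R1R/(allP R1l).
- by apply/allP => c cl /=; apply/R2R/(allP R2l').
Qed.

Lemma decomposable_mul U V R1 R2 R P Q :
    (forall c d, R1 c -> R2 d -> index_le c d) -> subpred R1 R -> subpred R2 R ->
    decomposable U V R1 P -> decomposable U V R2 Q ->
  decomposable U V R (set_mul P Q).
Proof.
move=> R12 R1R R2R [L ordL ->] [L' ordL' ->].
exists [seq coset_mul l l' | l <- L, l' <- L'].
  apply/allP => _ /allpairsP[[l l'] [/= lL l'L ->]].
  by apply: pieces_ordered_mul (allP ordL _ lL) (allP ordL' _ l'L).
apply/seteqP; split=> x.
  move=> [a [l lL la] [c [l' l'L lc] <-]]; exists (coset_mul l l').
    by apply/allpairsP; exists (l, l').
  by rewrite -pieces_coset_mul; exists a => //; exists c.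
move=> [_ /allpairsP[[l l'] [/= lL l'L ->]]].
rewrite -pieces_coset_mul => -[a la [c lc <-]].
by exists a; [exists l | exists c => //; exists l'].
Qed.

Lemma decomposable_point U V R x : decomposable U V R [set x].
Proof.
exists [:: (x, [::])] => //.
rewrite /pieces_coset /pieces_prod; apply/seteqP; split=> y.
  move=> ->; exists (x, [::]); first exact: mem_head.
  by rewrite big_nil; exists 1; rewrite ?mulg1.
move=> [l]; rewrite mem_seq1 => /eqP -> /=.
by rewrite big_nil => -[_ -> <-]; rewrite mulg1.
Qed.

Lemma decomposable_mulr U V R P b :
  decomposable U V R P -> decomposable U V R (set_mul P [set b]).
Proof.
move=> decP; apply: (@decomposable_mul U V R pred0 R) => //.
exact: decomposable_point.
Qed.

Lemma decomposable_mull U V R P b :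
  decomposable U V R P -> decomposable U V R (set_mul [set b] P).
Proof.
move=> decP; apply: (@decomposable_mul U V pred0 R R) => //.
exact: decomposable_point.
Qed.

Lemma decomposable0 U V R : decomposable U V R set0.
Proof. by exists [::] => //; apply/seteqP; split=> x // -[]. Qed.

Lemma decomposableU U V R P Q : decomposable U V R P -> decomposable U V R Q ->
  decomposable U V R (P `|` Q).
Proof.
move=> [L ordL ->] [L' ordL' ->]; exists (L ++ L'); first by rewrite all_cat ordL.
apply/seteqP; split=> x.
  by move=> [] [l lL lx]; exists l; rewrite // mem_cat lL ?orbT.
by move=> [l]; rewrite mem_cat => /orP[] lL lx; [left | right]; exists l.
Qed.

Lemma decomposable_bigcup (T : eqType) (s : seq T) (C : T -> Prop)
    (F : T -> set G) U V R :
    (forall t, C t -> decomposable U V R (F t)) ->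
  decomposable U V R [set x | exists t, [/\ t \in s, C t & F t x]].
Proof.
move=> decF; elim: s => [|t s IHs].
  have -> : [set x | exists t, [/\ t \in [::], C t & F t x]] = set0.
    by apply/seteqP; split=> x // -[? []].
  exact: decomposable0.
have [Ct|nCt] := pselect (C t); last first.
  congr decomposable: IHs; apply/seteqP; split=> x [u [us Cu Fu]]; exists u.
    by rewrite inE us orbT.
  by move: us; rewrite inE => /predU1P[ut|//]; rewrite ut in Cu.
congr decomposable: (decomposableU (decF t Ct) IHs); apply/seteqP; split=> x.
  move=> [Ft|[u [us Cu Fu]]]; first by exists t; rewrite mem_head.
  by exists u; rewrite inE us orbT.
move=> [u [us Cu Fu]]; move: us; rewrite inE => /predU1P[ut|us].
  by left; rewrite -ut.
by right; exists u.
Qed.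

Definition index_swap (c : nat * nat) := (c.2, c.1).

Definition piece_swap q : piece := (index_swap q.1, (q.2.2, q.2.1)).

Lemma decomposable_swap U V R P :
  decomposable V U (R \o index_swap) P -> decomposable U V R P.
Proof.
move=> [L ordL ->]; pose swap l := (l.1, map piece_swap l.2).
have swapE l : pieces_coset U V (swap l) = pieces_coset V U l.
  rewrite /pieces_coset /pieces_prod big_map /=; congr translate.
  by apply: eq_bigr => q _; rewrite /piece_set setIC.
exists (map swap L).
  rewrite all_map; apply: sub_all ordL => l /andP[ord_l Rl].
  rewrite /= /pieces_ordered pairwise_map all_map Rl andbT.
  move: ord_l; congr (is_true _); apply: eq_pairwise => q q'.
  by rewrite /index_le andbC.
apply/seteqP; split=> x => [[l lL lx]|[_ /mapP[l lL ->]]].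
  by exists (swap l); rewrite ?map_f ?swapE.
by rewrite swapE; exists l.
Qed.

End Decomposable.

(** * Splitting an intersection of products *)

Section Meeting.
Variables (G : groupType) (A : seq G).
Hypotheses (hA : symmetrized_generating_set A) (hG : hyperbolic A).
Variables U V : nat -> set G.
Hypotheses (U_sub : forall i, subgroup (U i)) (V_sub : forall j, subgroup (V j)).
Hypotheses (U_qc : forall i, quasiconvex A (U i)).
Hypotheses (V_qc : forall j, quasiconvex A (V j)).

Lemma near_broken_line j0 j1 f e b : j0 < j1 ->
  exists K, forall x c, interval_prod V j0 j1 (e^-1 * x * b^-1) ->
    between A f c x -> exists j w, [/\ j0 <= j < j1, near A K c w,
      interval_prod V j0 j.+1 (e^-1 * w) &
      interval_prod V j j1 (w^-1 * x * b^-1)].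
Proof.
move=> j01; have [delta slim_delta] := hyperbolic_slim hA hG.
have [K near_K] := interval_prod_near_geodesic hA hG V_sub V_qc j01.
(* The two short edges from e to f and from x to x b^-1 cost bounded detours. *)
have [lf near_ef] := near_exists hA e f; have [lb near_b] := near_exists hA 1 b.
exists (delta + (lf + delta + lb) + K) => x c Vx fcx.
have [d edx cd] : exists2 d, between A e d (x * b^-1) &
    near A (delta + (lf + delta + lb)) c d.
  have [u [fue|eux] cu] := slim_delta f x e c fcx.
    exists e; first exact: between_left.
    apply: near_trans cu _; apply: (@near_leq _ _ lf); first by lia.
    exact/(near_sym hA)/(between_near (between_sym hA fue) near_ef).
  have [v [ev|xv] uv] := slim_delta e x (x * b^-1) u eux.
    exists v => //; apply: near_trans cu _; apply: near_leq uv; by lia.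
  exists (x * b^-1); first exact/(between_sym hA)/between_left.
  have /(near_translate (x * b^-1)) : near A lb 1 b by [].
  rewrite mulg1 mulgVK => /(between_near xv)/(near_sym hA) vx.
  apply: near_trans cu _; apply: near_leq (near_trans uv vx); by lia.
have [|j [w [jj dw Vw Vwx]]] := near_K e (x * b^-1) d _ edx.
  by rewrite mulgA.
by exists j, w; split; rewrite -?mulgA //; apply: near_trans cd dw.
Qed.

(** The center of the geodesic triangle with vertices f, the end of the first
    side, and x lies close to the first side, to one of the later sides, and
    to the geodesic from f to x, hence to the other broken line. *)
Lemma meeting_point i0 i1 j0 j1 f e b : i0.+1 < i1 -> j0 < j1 ->
  exists K, forall x, interval_prod U i0 i1 (f^-1 * x) ->
    interval_prod V j0 j1 (e^-1 * x * b^-1) -> exists k j u v w,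
    [/\ i0 < k < i1 /\ j0 <= j < j1, near A K u v /\ near A K u w,
        U i0 (f^-1 * u) /\ interval_prod V j0 j.+1 (e^-1 * w),
        interval_prod U i0 k.+1 (u^-1 * v) &
        interval_prod U k i1 (v^-1 * x) /\
        interval_prod V j j1 (w^-1 * x * b^-1)].
Proof.
move=> i01 j01; have [delta slim_delta] := hyperbolic_slim hA hG.
have [K1 near_K1] :=
  interval_prod_near_geodesic hA hG U_sub U_qc (ltnSn i0).
have [K2 near_K2] := interval_prod_near_geodesic hA hG U_sub U_qc i01.
have [K3 near_K3] := near_broken_line f e b j01.
exists (K1 + delta + (delta.+1 + K2 + K3)) => x Ux Vx.
have [a Ua Uax] := interval_prod_cons (ltnW i01) Ux.
have [c [u' [v' [fcx fu' v'x cu' cv']]]] := slim_center hA f x (f * a) slim_delta.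
have [|l [u [il u'u Uu Uua]]] := near_K1 f (f * a) u' _ fu'.
  by rewrite mulKg interval_prod1.
have {il}l_i0 : l = i0 by lia.
rewrite {l}l_i0 !interval_prod1 in Uu Uua.
have [|k [v [ik v'v Uv Uvx]]] := near_K2 (f * a) x v' _ v'x.
  by rewrite invgM -mulgA.
have [j [w [jj cw Vw Vwx]]] := near_K3 x c Vx fcx.
have uc : near A (K1 + delta) u c.
  exact: near_trans (near_sym hA u'u) (near_sym hA cu').
exists k, j, u, v, w; split=> //.
  split; first by apply: near_leq (near_trans uc (near_trans cv' v'v)); lia.
  by apply: near_leq (near_trans uc cw); lia.
have -> : u^-1 * v = (u^-1 * (f * a)) * ((f * a)^-1 * v).
  by rewrite !reduce_word.
apply: (interval_prodM (leqnSn i0)) Uv; first by lia.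
by rewrite interval_prod1.
Qed.

End Meeting.

Section Intersection.
Variables (G : groupType) (A : seq G).
Hypotheses (hA : symmetrized_generating_set A) (hG : hyperbolic A).
Implicit Types (U V : nat -> set G) (f e b x : G).

Definition index_box i0 i1 j0 j1 : pred (nat * nat) :=
  fun c => (i0 <= c.1 < i1) && (j0 <= c.2 < j1).

(** The right factor b makes the family stable under the splitting and under
    exchanging the two sides; it avoids replacing V by conjugates, whose
    quasiconvexity would have to be shown. *)
Definition prod_meet U V i0 i1 j0 j1 f e b : set G :=
  [set x | interval_prod U i0 i1 (f^-1 * x) /\
           interval_prod V j0 j1 (e^-1 * x * b^-1)].

Lemma prod_meet_swap U V i0 i1 j0 j1 f e b :
  prod_meet U V i0 i1 j0 j1 f e b =
  set_mul (prod_meet V U j0 j1 i0 i1 e f b^-1) [set b].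
Proof.
apply/seteqP; split=> x.
  move=> [Ux Vx]; exists (x * b^-1); last by exists b; rewrite ?mulgVK.
  by split; rewrite ?invgK mulgA // mulgVK.
move=> [y [Vy Uy] [_ -> <-]]; split; last by rewrite mulgA mulgK.
by move: Uy; rewrite invgK mulgA.
Qed.

(** Any common point serves as the representative of both cosets; the right
    factor b then turns the second subgroup into its conjugate by b^-1. *)
Lemma decomposable_coset_meet U V i j f e b :
    subgroup (U i) -> subgroup (V j) ->
  decomposable U V (index_box i i.+1 j j.+1) (prod_meet U V i i.+1 j j.+1 f e b).
Proof.
move=> [_ UM UV] [_ VM VV].
have [[x [Ux Vx]]|empty] :=
  pselect (exists x, prod_meet U V i i.+1 j j.+1 f e b x); last first.
  congr decomposable: (decomposable0 U V (index_box i i.+1 j j.+1)).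
  by apply/seteqP; split=> x // Mx; case: empty; exists x.
rewrite interval_prod1 in Ux; rewrite interval_prod1 in Vx.
exists [:: (x, [:: ((i, j), (1, b^-1))])].
  by rewrite /pieces_ordered /= /index_box /= !leqnn.
rewrite /prod_meet !interval_prod1; apply/seteqP; split=> y.
  move=> [Uy Vy]; exists (x, [:: ((i, j), (1, b^-1))]); first exact: mem_head.
  rewrite /pieces_coset /pieces_prod big_seq1; apply/translateP.
  split; apply/set_conjP => /=.
    rewrite invg1 mul1g mulg1.
    have -> : x^-1 * y = (f^-1 * x)^-1 * (f^-1 * y) by rewrite !reduce_word.
    by apply: UM => //; apply: UV.
  have -> : b^-1^-1 * (x^-1 * y) * b^-1 = (e^-1 * x * b^-1)^-1 * (e^-1 * y * b^-1).
    by rewrite !reduce_word.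
  by apply: VM => //; apply: VV.
move=> [l]; rewrite mem_seq1 => /eqP ->.
rewrite /pieces_coset /pieces_prod big_seq1 => /translateP[/set_conjP + /set_conjP].
rewrite /= invg1 mul1g mulg1 => Uxy Vxy; split.
  have -> : f^-1 * y = (f^-1 * x) * (x^-1 * y) by rewrite !reduce_word.
  exact: UM.
have -> : e^-1 * y * b^-1 =
    (e^-1 * x * b^-1) * (b^-1^-1 * (x^-1 * y) * b^-1) by rewrite !reduce_word.
exact: VM.
Qed.

(** At the meeting points, x = u * a * (v^-1 * x) with a = u^-1 * v, and
    u = w * c with c = w^-1 * u. As a and c are short they take finitely many
    values, and once they are fixed u and v^-1 * x range over intersections
    with fewer factors independently of each other. *)
Lemma prod_meet_split U V i0 i1 j0 j1 f e b :
    (forall i, subgroup (U i)) -> (forall j, subgroup (V j)) ->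
    (forall i, quasiconvex A (U i)) -> (forall j, quasiconvex A (V j)) ->
    i0.+1 < i1 -> j0 < j1 ->
    (forall k l k' l' f e b, k < l -> k' < l' ->
       (l - k) + (l' - k') < (i1 - i0) + (j1 - j0) ->
       decomposable U V (index_box k l k' l') (prod_meet U V k l k' l' f e b)) ->
  decomposable U V (index_box i0 i1 j0 j1) (prod_meet U V i0 i1 j0 j1 f e b).
Proof.
move=> U_sub V_sub U_qc V_qc i01 j01 IH.
have [K meet_K] := meeting_point hA hG U_sub V_sub U_qc V_qc f e b i01 j01.
have [s near_s] := near_finite A K.
pose C (t : (nat * nat) * (G * G)) :=
  [/\ i0 < t.1.1 < i1, j0 <= t.1.2 < j1 & interval_prod U i0 t.1.1.+1 t.2.1].
pose F (t : (nat * nat) * (G * G)) :=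
  set_mul (prod_meet U V i0 i0.+1 j0 t.1.2.+1 f e t.2.2)
    (set_mul [set t.2.1]
       (prod_meet U V t.1.1 i1 t.1.2 j1 1 (t.2.2 * t.2.1)^-1 b)).
pose T := [seq (kj, ac) | kj <- [seq (k, j) | k <- iota 0 i1, j <- iota 0 j1],
                          ac <- [seq (a, c) | a <- s, c <- s]].
have decF t : C t -> decomposable U V (index_box i0 i1 j0 j1) (F t).
  case: t => [[k j] [a c]] [/= ik jj _]; rewrite /F /=.
  apply: (decomposable_mul _ _ _ (IH _ _ _ _ _ _ _ _ _ _)
           (decomposable_mull _ (IH _ _ _ _ _ _ _ _ _ _))); try by lia.
  - by move=> d d'; rewrite /index_box /index_le; lia.
  - by move=> d; rewrite /index_box; lia.
  - by move=> d; rewrite /index_box; lia.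
congr decomposable: (decomposable_bigcup T decF).
apply/seteqP; split=> x.
  move=> [[[k j] [a c]] [_ [/= ik jj Ua]]].
  move=> [u [Uu Vu] [_ [_ -> [z [Uz Vz] <-]] <-]].
  rewrite interval_prod1 in Uu; rewrite invg1 mul1g in Uz; rewrite invgK in Vz.
  case/andP: ik => ik ki; case/andP: jj => jj0 jj1; split.
    have -> : f^-1 * (u * (a * z)) = (f^-1 * u) * (a * z) by rewrite !reduce_word.
    apply: (interval_prod_overlap U_sub (leqnn i0) (ltnW i01)).
      by rewrite interval_prod1.
    exact: (interval_prod_overlap U_sub (ltnW ik) ki).
  have -> : e^-1 * (u * (a * z)) * b^-1 =
      (e^-1 * u * c^-1) * (c * a * z * b^-1) by rewrite !reduce_word.
  exact: (interval_prod_overlap V_sub jj0 jj1).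
move=> [Ux Vx].
have [k [j [u [v [w [[ik jj] [uv uw] [Uu Vw] Uuv [Uvx Vwx]]]]]]] := meet_K x Ux Vx.
exists ((k, j), (u^-1 * v, w^-1 * u)); split=> //.
  apply/allpairsP; exists ((k, j), (u^-1 * v, w^-1 * u)); split=> //=.
    by apply/allpairsP; exists (k, j); split=> //=; rewrite mem_iota; lia.
  apply/allpairsP; exists (u^-1 * v, w^-1 * u); split=> //=; apply: near_s => //.
  exact: near_sym.
exists u => /=.
  split; first by rewrite interval_prod1.
  by move: Vw; congr interval_prod; rewrite !reduce_word.
exists (u^-1 * x); last by rewrite mulVKg.
exists (u^-1 * v) => //; exists (v^-1 * x); last by rewrite !reduce_word.
split; first by rewrite invg1 mul1g.
by move: Vwx; congr interval_prod; rewrite !reduce_word.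
Qed.

Lemma decomposable_prod_meet U V i0 i1 j0 j1 f e b :
    (forall i, subgroup (U i)) -> (forall j, subgroup (V j)) ->
    (forall i, quasiconvex A (U i)) -> (forall j, quasiconvex A (V j)) ->
    i0 < i1 -> j0 < j1 ->
  decomposable U V (index_box i0 i1 j0 j1) (prod_meet U V i0 i1 j0 j1 f e b).
Proof.
have [N] := ubnP ((i1 - i0) + (j1 - j0)).
elim: N U V i0 i1 j0 j1 f e b => // N IHN U V i0 i1 j0 j1 f e b ltN.
move=> U_sub V_sub U_qc V_qc i01 j01.
have [i01' | i01'] := ltnP i0.+1 i1.
  by apply: prod_meet_split => // *; apply: IHN => //; lia.
have [j01' | j01'] := ltnP j0.+1 j1.
  rewrite prod_meet_swap; apply/decomposable_mulr/decomposable_swap.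
  have -> : index_box i0 i1 j0 j1 \o @index_swap = index_box j0 j1 i0 i1.
    by apply/funext => c; rewrite /index_box /= andbC.
  by apply: prod_meet_split => // *; apply: IHN => //; lia.
have -> : i1 = i0.+1 by lia.
have -> : j1 = j0.+1 by lia.
exact: decomposable_coset_meet.
Qed.

End Intersection.

(** * The intersection theorem *)

Theorem theorem1 (G : groupType) (A : seq G)
    (hA : symmetrized_generating_set A) (hG : hyperbolic A)
    (n m : nat) (n_gt0 : (0 < n)%N) (m_gt0 : (0 < m)%N)
    (G_ : 'I_n -> set G) (H_ : 'I_m -> set G)
    (G_sub : forall i, subgroup (G_ i)) (G_qc : forall i, quasiconvex A (G_ i))
    (H_sub : forall j, subgroup (H_ j)) (H_qc : forall j, quasiconvex A (H_ j))
    (f e : G) :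
  exists (r : nat) (t : 'I_r -> nat) (f_ : 'I_r -> G)
         (alpha beta : forall l : 'I_r, 'I_(t l) -> G)
         (S_ : 'I_r -> set G),
    translate f (set_prod G_) `&` translate e (set_prod H_) =
      \bigcup_(l in [set: 'I_r]) translate (f_ l) (S_ l)
    /\ forall l : 'I_r,
         exists (i : 'I_(t l) -> 'I_n) (j : 'I_(t l) -> 'I_m),
           [/\ forall k k' : 'I_(t l), (k <= k')%N -> (i k <= i k')%N,
               forall k k' : 'I_(t l), (k <= k')%N -> (j k <= j k')%N
             & S_ l = set_prod (fun k : 'I_(t l) =>
                 set_conj (G_ (i k)) (alpha l k) `&`
                 set_conj (H_ (j k)) (beta l k))].
Proof.
(* The induction uses families indexed by nat; values outside the range are
   arbitrary. *)
pose toI k (k_gt0 : 0 < k) : nat -> 'I_k := insubd (Ordinal k_gt0).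
have toIK k (k_gt0 : 0 < k) i : i < k -> toI k k_gt0 i = i :> nat.
  by move=> ik; rewrite /toI val_insubd ik.
pose U i := G_ (toI n n_gt0 i); pose V j := H_ (toI m m_gt0 j).
have prodE k (k_gt0 : 0 < k) (F : 'I_k -> set G) :
    set_prod F = interval_prod (F \o toI k k_gt0) 0 k.
  rewrite /interval_prod big_mkord; apply: eq_bigr => i _ /=.
  by congr F; apply/val_inj; rewrite /= toIK.
have [L ordL defL] := @decomposable_prod_meet G A hA hG U V 0 n 0 m f e 1
  (fun=> G_sub _) (fun=> H_sub _) (fun=> G_qc _) (fun=> H_qc _) n_gt0 m_gt0.
pose c (l : 'I_(size L)) := tnth (in_tuple L) l.
pose q l : 'I_(size (c l).2) -> _ := tnth (in_tuple (c l).2).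
exists (size L), (fun l => size (c l).2), (fun l => (c l).1).
exists (fun l k => (q l k).2.1), (fun l k => (q l k).2.2).
exists (fun l => pieces_prod U V (c l).2); split.
  transitivity (prod_meet U V 0 n 0 m f e 1).
    rewrite (prodE n n_gt0) (prodE m m_gt0); apply/seteqP; split=> x.
      by move=> [/translateP Gx /translateP Hx]; split; rewrite // invg1 mulg1.
    move=> [Gx]; rewrite invg1 mulg1 => Hx.
    by split; apply/translateP.
  rewrite defL; apply/seteqP; split=> x => [[l lL lx]|[l _ lx]].
    have /tnthP[l' def_l] : l \in in_tuple L by [].
    by exists l' => //; rewrite /c -def_l.
  by exists (c l) => //; apply: mem_tnth.
move=> l; have /andP[ord_l box_l] := allP ordL _ (mem_tnth l (in_tuple L)).
have box k : index_box 0 n 0 m (q l k).1.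
  exact: (allP box_l) _ (mem_tnth k (in_tuple (c l).2)).
have q_le (k k' : 'I_(size (c l).2)) : k <= k' -> index_le (q l k).1 (q l k').1.
  rewrite leq_eqVlt => /predU1P[/val_inj ->|kk']; first by rewrite /index_le !leqnn.
  rewrite /q !(tnth_nth ((0, 0), (1, 1))).
  move/pairwiseP: ord_l => /(_ ((0, 0), (1, 1)))/(_ k k' (ltn_ord k) (ltn_ord k')).
  exact.
exists (fun k => toI n n_gt0 (q l k).1.1), (fun k => toI m m_gt0 (q l k).1.2).
split=> [k k' /q_le|k k' /q_le|].
- have := box k; have := box k'; rewrite /index_box /index_le => ? ? ?.
  by rewrite !toIK; lia.
- have := box k; have := box k'; rewrite /index_box /index_le => ? ? ?.
  by rewrite !toIK; lia.
- by rewrite /pieces_prod big_tnth.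
Qed.
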